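(* Let $U\subseteq\mathbb Z$ be infinite. If $f\in LIP(U)$ and $|f(x)|$ is a prime number for infinitely many $x\in U$, then $f$ is irreducible in the ring $LIP(U)$.
   Context: For an infinite $U\subseteq\mathbb Z$, a function $f\colon U\to\mathbb Z$ is LIP on $U$ if for every finite $X\subseteq U$ there is $p\in\mathbb Z[x]$ with $p(x)=f(x)$ for all $x\in X$; $LIP(U)$ is the ring of all such functions under pointwise operations. *)

(* Defs.v *)
From HB Require Import structures.
From mathcomp Require Import all_boot all_order all_algebra.
From mathcomp Require Import all_classical.

Set Implicit Arguments.
Unset Strict Implicit.
Unset Printing Implicit Defensive.

Import Order.TTheory GRing.Theory Num.Theory.
Local Open Scope classical_set_scope.
Local Open Scope ring_scope.

(* A function U -> Z is an [f : U -> int], where [U : set int] is coerced to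
   the type [{x : int | x \in U}] of its elements. *)
Definition is_LIP (U : set int) (f : U -> int) : Prop :=
  forall X : set U, finite_set X ->
    exists p : {poly int}, forall x : U, X x -> p.[val x] = f x.

Definition LIP_pred (U : set int) : {pred (U -> int)} :=
  fun f => `[< is_LIP f >].
Arguments LIP_pred U _ : clear implicits.

Lemma LIP_subring_closed (U : set int) : subring_closed (LIP_pred U).
Proof.
split=> [|f g /asboolP fL /asboolP gL|f g /asboolP fL /asboolP gL];
  apply/asboolP => X finX.
- by exists 1 => x _; rewrite hornerC.
- have [p pf] := fL X finX; have [q qg] := gL X finX.
  by exists (p - q) => x Xx; rewrite !hornerE pf // qg.
- have [p pf] := fL X finX; have [q qg] := gL X finX.
  by exists (p * q) => x Xx; rewrite hornerM pf // qg.
Qed.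

HB.instance Definition _ (U : set int) :=
  GRing.isSubringClosed.Build (U -> int) (LIP_pred U) (@LIP_subring_closed U).

Record LIP (U : set int) := MkLIP {
  LIP_fun :> U -> int;
  LIP_funP : LIP_fun \in LIP_pred U
}.

HB.instance Definition _ (U : set int) := [isSub for @LIP_fun U].
HB.instance Definition _ (U : set int) := [Choice of LIP U by <:].
(* The ring operations are inherited from the pointwise ones of [U -> int]. *)
HB.instance Definition _ (U : set int) :=
  GRing.SubChoice_isSubComPzRing.Build (U -> int) (LIP_pred U) (LIP U)
    (@LIP_subring_closed U).

(* [GRing.unit] is not available: [LIP U] is not declared as a [unitRingType]
   (it is the zero ring when [U] is empty). *)
Definition is_unit (R : comPzRingType) (a : R) : Prop := exists b : R, a * b = 1.

Definition irreducible_elt (R : comPzRingType) (a : R) : Prop :=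
  [/\ a <> 0, ~ is_unit a
    & forall b c : R, a = b * c -> is_unit b \/ is_unit c].

(* Main.v *)
Require Import Defs.
From HB Require Import structures.
From mathcomp Require Import all_boot all_order all_algebra.
From mathcomp Require Import all_classical.

(** A LIP function satisfies [x - y %| g x - g y].  If [g] takes a value [c]
    at infinitely many [x], then [c - g y] has infinitely many divisors
    [x - y], hence vanishes: [g] is constant.  In a factorization
    [f = g * h], infinitely many prime values of [f] force one of [g], [h] to
    take one of the values [1], [-1] infinitely often. *)

Set Implicit Arguments.
Unset Strict Implicit.
Unset Printing Implicit Defensive.

Import Order.TTheory GRing.Theory Num.Theory.
Local Open Scope classical_set_scope.
Local Open Scope ring_scope.

Lemma dvdz_horner_sub (p : {poly int}) (x y : int) :
  (x - y %| p.[x] - p.[y])%Z.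
Proof.
have /factor_theorem[q pE] : root (p - p.[y]%:P) y.
  by rewrite rootE !hornerE subrr.
have -> : p.[x] - p.[y] = q.[x] * (x - y).
  by have := congr1 (horner^~ x) pE; rewrite !hornerE.
exact: dvdz_mull.
Qed.

(** A polynomial agreeing with [g] at just the two points [x] and [y] transfers the divisibility to
    [g]. *)
Lemma LIP_dvdz_sub (U : set int) (g : LIP U) (x y : U) :
  (val x - val y %| g x - g y)%Z.
Proof.
have /asboolP gL := LIP_funP g.
have [p pg] := gL [set x; y] (finite_set2 x y).
by rewrite -(pg x) -?(pg y); [exact: dvdz_horner_sub|right|left].
Qed.

Lemma finite_dvdz (n : int) : n != 0 -> finite_set [set d : int | (d %| n)%Z].
Proof.
move=> n0; set D := map Posz (divisors `|n|).
apply: (sub_finite_set _ (finite_seq (D ++ map -%R D))) => d /= dn.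
have dD : `|d|%:Z \in D by rewrite map_f // -dvdn_divisors ?absz_gt0.
rewrite mem_cat; case: (ger0P d) => d0.
- by rewrite -(gez0_abs d0) dD.
- by rewrite -[d]opprK -(ltz0_abs d0) map_f ?orbT.
Qed.

Lemma LIP_constant (U : set int) (g : LIP U) (c : int) :
  infinite_set [set x : U | g x = c] -> forall y : U, g y = c.
Proof.
move=> gc y; apply/eqP; apply: contra_notT gc => gyc.
have cgy0 : c - g y != 0 by rewrite subr_eq0 eq_sym.
(* Injectivity makes the preimage of the finite set of divisors of [c - g y] finite. *)
have inj : injective (fun x : U => val x - val y).
  by move=> u v /addIr /val_inj.
apply: sub_finite_set (finite_preimage (in2W inj) (finite_dvdz cgy0)).
by move=> x /= <-; exact: LIP_dvdz_sub.
Qed.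

(** One of the values [1], [-1] is taken infinitely often, so [g] is constant with square [1], hence
    its own inverse. *)
Lemma LIP_unit (U : set int) (g : LIP U) :
  infinite_set [set x : U | `|g x|%N = 1%N] -> is_unit g.
Proof.
move=> g1; have [c cc gc] : exists2 c : int, c * c = 1 & forall x, g x = c.
  have [fin1|inf1] := pselect (finite_set [set x : U | g x = 1]); last first.
    by exists 1; rewrite ?mulr1 //; exact: LIP_constant.
  exists (-1); rewrite ?mulrNN ?mulr1 //; apply: LIP_constant => finN1.
  apply: g1; apply: (@sub_finite_set _ _
    ([set x : U | g x = 1] `|` [set x : U | g x = -1])) => [x /= gx|].
    by have := mulz_sign_abs (g x); rewrite gx mulr1; case: (_ < _); [right|left].
  by rewrite finite_setU.
by exists g; apply: val_inj; apply/funext => x; rewrite -[RHS]cc -(gc x).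
Qed.

Theorem theorem2 (U : set int) (hU : infinite_set U) (f : LIP U)
    (hf : infinite_set [set x : U | prime `|f x|%N]) :
  irreducible_elt f.
Proof.
have [x fx] := infinite_setN0 hf.
split=> [f0|[b fb]|g h fgh].
- by move: fx; rewrite /= f0.
- have /= /(congr1 absz) := congr1 (fun k : LIP U => k x) fb.
  rewrite abszM => /eqP; rewrite muln_eq1 => /andP[/eqP fx1 _].
  by move: fx; rewrite /= fx1.
- have [fing|infg] := pselect (finite_set [set x : U | `|g x|%N = 1%N]);
    last by left; exact: LIP_unit.
  (* Were [h] also of absolute value [1] only finitely often, [f] would have only finitely many
     prime values up to sign. *)
  right; apply: LIP_unit => finh; apply: hf.
  apply: (@sub_finite_set _ _
    ([set x : U | `|g x|%N = 1%N] `|` [set x : U | `|h x|%N = 1%N]));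
    last by rewrite finite_setU.
  move=> y /=; rewrite fgh abszM => pr.
  (* The divisor [|g y|] of a prime is [1] or the whole product; in the latter case cancelling it
     leaves [|h y| = 1]. *)
  case/primeP: (pr) => _ /(_ _ (dvdn_mulr _ (dvdnn _))) /orP[/eqP|/eqP gE].
    by left.
  right; apply/eqP; rewrite -(eqn_pmul2l (m := `|g y|)) ?muln1 -?gE //.
  by rewrite gE prime_gt0.
Qed.
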